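(* Let $n\ge2$, let $G$ be a connected graph on $V=\{0,1,\dots,n\}$ with root $0$, let $e_0$ be an edge of $G$ joining the root $0$ to the vertex $n$, and let $G'=G-\{e_0\}$. Then \[ \mathcal{M}_{G'}=(\mathcal{M}_G:x_n)=\{z\in R: z\cdot x_n\in\mathcal{M}_G\}. \] Further, multiplication by $x_n$ induces a bijection \[ \mu_{x_n}:\{\mathbf{x}^{\mathcal{P}}:\mathcal{P}\in\mathrm{sPF}(G')\}\longrightarrow\{\mathbf{x}^{\mathcal{P}}:\mathcal{P}\in\mathrm{sPF}(G)\}. \] In particular, $|\mathrm{sPF}(G)|=|\mathrm{sPF}(G')|$.
   Context: $\mathbb{N}=\{0,1,2,\dots\}$, $[n]=\{1,\dots,n\}$; graphs are undirected and loopless, multiple edges allowed; $G-\{e_0\}$ is obtained by deleting the single edge $e_0$ (it need not be connected). $R=\mathbb{K}[x_1,\dots,x_n]$ over a field $\mathbb{K}$. For a graph $G$ on $V$ (connected or not) with $a_{ij}$ edges between $i$ and $j$, and $\emptyset\ne A\subseteq[n]$, put $d_A(i)=\sum_{j\in V\setminus A}a_{ij}$ and $m_A=\prod_{i\in A}x_i^{d_A(i)}$. Let $\mathcal{M}_G=\langle m_A:\emptyset\neq A\subseteq[n]\rangle$ and $\mathcal{M}_G^{(k)}=\langle m_A:\emptyset\ne A\subseteq[n],\ |A|\le k+1\rangle$ for $0\le k\le n-1$. The set of spherical $G$-parking functions is $\mathrm{sPF}(G)=\{\mathcal{P}=(p_1,\dots,p_n)\in\mathbb{N}^n:\ \mathbf{x}^{\mathcal{P}}=\prod_i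 x_i^{p_i}\in\mathcal{M}_G\setminus\mathcal{M}_G^{(n-2)}\}$. *)

(* Defs.v *)
From HB Require Import structures.
From mathcomp Require Import all_boot all_order all_algebra.
From mathcomp Require Import boolp classical_sets functions cardinality finmap.
From mathcomp Require Import mpoly.

Set Implicit Arguments.
Unset Strict Implicit.
Unset Printing Implicit Defensive.

Import GRing.Theory.
Local Open Scope ring_scope.

(* Finite undirected loopless multigraphs; distinct edges may have the same
   pair of end points. *)
Record mgraph (V : finType) := MGraph {
  edge : finType;
  ends : edge -> {set V};
  card_ends : forall e, #|ends e| = 2 }.

Definition mult (V : finType) (G : mgraph V) (i j : V) : nat :=
  #|[pred e : edge G | ends e == [set i; j]%SET]|.

Definition adjacent (V : finType) (G : mgraph V) : rel V :=
  [rel i j | (0 < mult G i j)%N].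

Definition connected_graph (V : finType) (G : mgraph V) : Prop :=
  forall i j : V, connect (adjacent G) i j.

Definition del_edge (V : finType) (G : mgraph V) (e0 : edge G) : mgraph V :=
  @MGraph V {e : edge G | e != e0} (fun e => ends (val e))
    (fun e => card_ends (val e)).

(* The vertex set {0, ..., n} is 'I_n.+1, with root ord0. A non-root vertex
   v in [n] is indexed by v - 1 : 'I_n, so that the variable x_v is 'X_(v - 1);
   vertex recovers the vertex from its index. *)
Definition vertex (n : nat) (i : 'I_n) : 'I_n.+1 := lift ord0 i.

Definition vertices (n : nat) (A : {set 'I_n}) : {set 'I_n.+1} :=
  [set vertex i | i in A]%SET.

(* The index of the vertex n, i.e. the element n - 1 of 'I_n. *)
Definition last_index (n : nat) (hn : (2 <= n)%N) : 'I_n :=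
  Ordinal (etrans (ltn_predL n) (ltnW hn)).

Definition outdeg (n : nat) (G : mgraph 'I_n.+1) (A : {set 'I_n}) (i : 'I_n) :
    nat :=
  (\sum_(j in ~: vertices A) mult G (vertex i) j)%N.

Definition cut_monomial (K : fieldType) (n : nat) (G : mgraph 'I_n.+1)
    (A : {set 'I_n}) : {mpoly K[n]} :=
  \prod_(i in A) 'X_i ^+ outdeg G A i.

Definition generated_ideal (R : comNzRingType) (I : finType) (P : pred I)
    (g : I -> R) : set R :=
  [set z | exists c : I -> R, z = \sum_(i | P i) c i * g i]%classic.

Definition colon_ideal (R : comNzRingType) (J : set R) (x : R) : set R :=
  [set z | J (z * x)]%classic.

Definition parking_ideal (K : fieldType) (n : nat) (G : mgraph 'I_n.+1) :
    set {mpoly K[n]} :=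
  generated_ideal [pred A : {set 'I_n} | A != finset.set0] (cut_monomial K G).

Definition skeleton_ideal (K : fieldType) (n : nat) (G : mgraph 'I_n.+1)
    (k : nat) : set {mpoly K[n]} :=
  generated_ideal
    [pred A : {set 'I_n} | (A != finset.set0) && (#|A| <= k.+1)%N]
    (cut_monomial K G).

Arguments parking_ideal K {n} G _.
Arguments skeleton_ideal K {n} G k _.

(* Only meaningful for n >= 2, since n - 2 is truncated. *)
Definition sPF (K : fieldType) (n : nat) (G : mgraph 'I_n.+1) :
    set 'X_{1..n} :=
  [set p | (parking_ideal K G `\` skeleton_ideal K G (n - 2)) 'X_[p]]%classic.

Arguments sPF K {n} G _.

Definition sPF_monomials (K : fieldType) (n : nat) (G : mgraph 'I_n.+1) :
    set {mpoly K[n]} :=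
  [set 'X_[p] | p in sPF K G]%classic.

Arguments sPF_monomials K {n} G _.

(* Main.v *)
(** All ideals involved are monomial, so membership is decided monomial by
    monomial through divisibility by a generator. Deleting an edge from the root
    to the vertex [n] divides [m_A] by [x_n] when [n] lies in [A] and leaves it
    unchanged, free of [x_n], otherwise. Hence the [m_A] of [G] divides [x_n x^p]
    iff that of [G'] divides [x^p], which gives the colon formula for the
    parking ideal and for its skeletons alike. For [p] in [sPF(G)] the only [m_A]
    dividing [x^p] is [m_[n]], a multiple of [x_n], whence surjectivity.
    Finiteness follows from [A] a singleton, which bounds each [p_i]. *)

Require Import Defs.
From HB Require Import structures.
From mathcomp Require Import all_boot all_order all_algebra.
From mathcomp Require Import boolp classical_sets functions cardinality finmap.
From mathcomp Require Import mpoly.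

Set Implicit Arguments.
Unset Strict Implicit.
Unset Printing Implicit Defensive.

Import GRing.Theory.
Local Open Scope ring_scope.

(** Multiplying by ['X_[m i]] moves every exponent above [m i], and sums create no new exponents.
    Conversely [z] is the sum of its terms, each a multiple of some generator. *)
Lemma generated_ideal_monomialP (K : fieldType) (n : nat) (I : finType)
    (P : pred I) (m : I -> 'X_{1..n}) (z : {mpoly K[n]}) :
  generated_ideal P (fun i => 'X_[m i]) z <->
  forall p, p \in msupp z -> exists2 i, P i & (m i <= p)%MM.
Proof.
split=> [[c ->] p|supp_z].
  rewrite mcoeff_msupp => nz.
  (* If no generator divides ['X_[p]], every summand has coefficient 0 at [p], contradicting
     [nz]. *)
  have [/existsP[i /andP[Pi le_ip]]|/existsPn noi] :=
    boolP [exists i, P i && (m i <= p)%MM]; first by exists i.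
  case/eqP: nz; rewrite raddf_sum big1 //= => i Pi.
  apply: contraTeq isT => nz /=.
  have: p \in msupp (c i * 'X_[m i]) by rewrite mcoeff_msupp.
  rewrite (perm_mem (msuppMX _ _)) => /mapP[q _ pE].
  by have := noi i; rewrite Pi pE lem_addr ?lepm_refl.
have addI (u v : {mpoly K[n]}) : generated_ideal P (fun i => 'X_[m i]) u ->
    generated_ideal P (fun i => 'X_[m i]) v ->
    generated_ideal P (fun i => 'X_[m i]) (u + v).
  move=> [c ->] [d ->]; exists (fun i => c i + d i).
  by rewrite -big_split; apply: eq_bigr => i _; rewrite mulrDl.
rewrite (mpolyE z) big_seq.
apply: (big_ind (generated_ideal P (fun i => 'X_[m i]))) => //.
  by exists (fun=> 0); rewrite big1 // => i _; rewrite mul0r.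
move=> p /supp_z[i Pi le_ip].
(* The whole term is charged to the single generator [i]; the truncated [p - m i] is exact because
   [m i <= p]. *)
exists (fun j => if j == i then z@_p *: 'X_[p - m i] else 0).
rewrite (bigD1 i) //= eqxx big1 => [|j /andP[_ /negPf->]]; last by rewrite mul0r.
by rewrite addr0 -scalerAl -mpolyXD submK.
Qed.

Lemma generated_ideal_monomialX (K : fieldType) (n : nat) (I : finType)
    (P : pred I) (m : I -> 'X_{1..n}) (p : 'X_{1..n}) :
  generated_ideal P (fun i => 'X_[m i] : {mpoly K[n]}) 'X_[p] <->
  exists2 i, P i & (m i <= p)%MM.
Proof.
rewrite generated_ideal_monomialP msuppX; split; first by apply; rewrite inE.
by move=> Pp q; rewrite inE => /eqP->.
Qed.

(** Multiplication by ['X_[u]] translates the support by [u], so the divisibility criterion for [z *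
    'X_[u]] becomes one for [z]. *)
Lemma colon_ideal_monomial (K : fieldType) (n : nat) (I : finType)
    (P : pred I) (m m' : I -> 'X_{1..n}) (u : 'X_{1..n}) :
    (forall i p, (m' i <= p)%MM = (m i <= u + p)%MM) ->
  generated_ideal P (fun i => 'X_[m' i] : {mpoly K[n]}) =
  colon_ideal (generated_ideal P (fun i => 'X_[m i])) 'X_[u].
Proof.
move=> mm'; apply/predeqP => z; rewrite /colon_ideal /=.
rewrite !generated_ideal_monomialP; split=> supp_z p.
  rewrite (perm_mem (msuppMX _ _)) => /mapP[q /supp_z[i Pi le_iq] ->].
  by exists i; rewrite // -mm'.
move=> zp; have [|i Pi le_i] := supp_z (u + p)%MM.
  by rewrite (perm_mem (msuppMX _ _)) map_f.
by exists i; rewrite // mm'.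
Qed.

Definition cut_exponent (n : nat) (G : mgraph 'I_n.+1) (A : {set 'I_n}) :
    'X_{1..n} :=
  [multinom (if i \in A then outdeg G A i else 0%N) | i < n].

Lemma cut_monomialE (K : fieldType) (n : nat) (G : mgraph 'I_n.+1) :
  cut_monomial K G = (fun A => 'X_[cut_exponent G A]).
Proof.
apply/funext => A; rewrite mpolyXE_id /cut_monomial big_mkcond.
by apply: eq_bigr => i _; rewrite mnmE; case: ifP.
Qed.

Lemma mult_del_edge (V : finType) (G : mgraph V) (e0 : edge G) (i j : V) :
  mult G i j = ((ends e0 == [set i; j]%SET) + mult (del_edge e0) i j)%N.
Proof.
rewrite /mult (cardD1 e0) inE; congr (_ + _)%N.
rewrite -(fintype.card_image (@val_inj _ _ {e : edge G | e != e0})).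
apply: eq_card => e; rewrite !inE; apply/andP/fintype.imageP.
  by case=> ne He; exists (exist _ e ne).
by case=> -[f nf] Hf ->.
Qed.

Lemma ord0_notin_vertices (n : nat) (A : {set 'I_n}) : ord0 \notin vertices A.
Proof. by apply/imsetP => -[i _ /eqP]; rewrite (negPf (neq_lift _ _)). Qed.

Lemma vertex_last_index (n : nat) (hn : (2 <= n)%N) :
  vertex (last_index hn) = ord_max.
Proof. by apply/val_inj; rewrite /= /bump /= add1n prednK // ltnW. Qed.

Section RootEdge.

Variables (n : nat) (hn : (2 <= n)%N) (G : mgraph 'I_n.+1) (e0 : edge G).
Hypothesis he0 : ends e0 = [set ord0; ord_max]%SET.

Let l := last_index hn.

Lemma root_edge_eq_pair (i : 'I_n) (j : 'I_n.+1) :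
  (ends e0 == [set vertex i; j]%SET) = (i == l) && (j == ord0).
Proof.
rewrite he0 -(vertex_last_index hn) -/l; apply/eqP/andP => [E|[/eqP-> /eqP->]].
  have: ord0 \in [set vertex i; j] by rewrite -E !inE eqxx.
  rewrite !inE (negPf (neq_lift _ _)) /= => /eqP j0.
  have: vertex l \in [set vertex i; j] by rewrite -E !inE eqxx orbT.
  rewrite !inE -j0 (eq_sym (vertex l) ord0) (negPf (neq_lift _ _)) orbF.
  by rewrite (inj_eq (@lift_inj _ _)) eq_sym eqxx.
by rewrite finset.setUC.
Qed.

(** The root lies outside [vertices A] for every [A], so [e0] is counted exactly once, at its
    non-root end. *)
Lemma outdeg_del_root_edge (A : {set 'I_n}) (i : 'I_n) :
  outdeg G A i = ((i == l) + outdeg (del_edge e0) A i)%N.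
Proof.
rewrite /outdeg; under eq_bigr do rewrite (mult_del_edge e0) root_edge_eq_pair.
rewrite big_split /=; congr (_ + _)%N.
rewrite (bigD1 ord0) ?inE ?ord0_notin_vertices //= eqxx andbT big1 ?addn0 //.
by move=> j /andP[_ /negPf->]; rewrite andbF.
Qed.

Lemma cut_exponent_del_root_edge (A : {set 'I_n}) (p : 'X_{1..n}) :
  (cut_exponent (del_edge e0) A <= p)%MM = (cut_exponent G A <= U_(l) + p)%MM.
Proof.
(* Off [A] the exponents on the left are 0; on [A] both sides of the inequality for [G] carry the
   same extra [i == l], which cancels. *)
apply/mnm_lepP/mnm_lepP => H i; move: (H i);
  rewrite !mnmE; case: ifP => // _; rewrite outdeg_del_root_edge eq_sym;
  by rewrite leq_add2l.
Qed.

Lemma parking_ideal_del_root_edge (K : fieldType) :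
  parking_ideal K (del_edge e0) = colon_ideal (parking_ideal K G) 'X_l.
Proof.
rewrite /parking_ideal !cut_monomialE; apply: colon_ideal_monomial => A p.
exact: cut_exponent_del_root_edge.
Qed.

Lemma skeleton_ideal_del_root_edge (K : fieldType) (k : nat) :
  skeleton_ideal K (del_edge e0) k = colon_ideal (skeleton_ideal K G k) 'X_l.
Proof.
rewrite /skeleton_ideal !cut_monomialE; apply: colon_ideal_monomial => A p.
exact: cut_exponent_del_root_edge.
Qed.

Lemma sPF_del_root_edge (K : fieldType) (p : 'X_{1..n}) :
  sPF K (del_edge e0) p = sPF K G (p + U_(l))%MM.
Proof.
rewrite /sPF /= parking_ideal_del_root_edge skeleton_ideal_del_root_edge.
by rewrite /colon_ideal /setD /= mpolyXD.
Qed.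

Lemma sPF_root_edge_gt0 (K : fieldType) (p : 'X_{1..n}) :
  sPF K G p -> (0 < p l)%N.
Proof.
rewrite /sPF /parking_ideal /skeleton_ideal !cut_monomialE /= => -[].
rewrite !generated_ideal_monomialX => -[A /= nzA /mnm_lepP le_Ap] noA.
have [lA|lA] := boolP (l \in A).
  by apply: leq_trans (le_Ap l); rewrite mnmE lA outdeg_del_root_edge eqxx.
(* A set missing [l] is proper, so it has at most [n - 1] elements; this is [(n - 2).+1] since
   [2 <= n], and [A] would index a skeleton generator. *)
case: noA; exists A; last exact/mnm_lepP.
rewrite /= nzA -subSn // subSS -ltnS subn1 prednK ?(ltnW hn) //.
rewrite -[X in (_ < X)%N](card_ord n) -cardsT proper_card // finset.properT.
by apply: contraNneq lA => ->; rewrite inE.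
Qed.

Lemma sPF_root_edgeE (K : fieldType) :
  sPF K G = [set (p + U_(l))%MM | p in sPF K (del_edge e0)]%classic.
Proof.
apply/seteqP; split=> [p Gp|_ [p + <-]]; last by rewrite sPF_del_root_edge.
(* Truncated subtraction of [U_(l)] is undone because [p l] is positive. *)
have pE : (p - U_(l) + U_(l))%MM = p.
  by rewrite submK // lep1mP -lt0n; apply: sPF_root_edge_gt0 Gp.
by exists (p - U_(l))%MM; rewrite ?sPF_del_root_edge pE.
Qed.

End RootEdge.

Lemma sPF_finite (K : fieldType) (n : nat) (hn : (2 <= n)%N)
  (G : mgraph 'I_n.+1) : finite_set (sPF K G).
Proof.
(* A bound on the total degree, which places all of [sPF K G] in the finite type of multinomials of
   degree below [b]. *)
pose b := (\sum_i outdeg G [set i] i).+1.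
apply: (@sub_finite_set _ _ (range (@bmnm n b))); last exact: finite_image.
rewrite /sPF /skeleton_ideal cut_monomialE => p /= [_].
rewrite generated_ideal_monomialX => noA.
have lt_pb : (mdeg p < b)%N.
  rewrite ltnS mdegE leq_sum // => i _; rewrite leqNgt; apply/negP => lt_i.
  case: noA; exists [set i]%SET; first by rewrite /= cards1 -card_gt0 cards1.
  apply/mnm_lepP => j; rewrite mnmE inE; case: eqP => // ->.
  exact: ltnW.
by exists (BMultinom lt_pb).
Qed.

Theorem lemma3p1 (K : fieldType) (n : nat) (hn : (2 <= n)%N)
    (G : mgraph 'I_n.+1) (hG : connected_graph G)
    (e0 : edge G) (he0 : ends e0 = [set ord0; ord_max]%SET) :
  let G' := del_edge e0 in
  let xn : {mpoly K[n]} := 'X_(last_index hn) in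
  [/\ parking_ideal K G' = colon_ideal (parking_ideal K G) xn,
      set_bij (sPF_monomials K G') (sPF_monomials K G) (fun z => z * xn)
    & [/\ finite_set (sPF K G), finite_set (sPF K G')
        & #|` fset_set (sPF K G)|%fset = #|` fset_set (sPF K G')|%fset ] ].
Proof.
move=> G' xn; have sPFE := sPF_root_edgeE hn he0 K.
have fin_sPF := sPF_finite K hn.
split; first exact: parking_ideal_del_root_edge.
- split.
  + move=> _ [p Gp <-]; exists (p + U_(last_index hn))%MM.
      by rewrite sPFE; exists p.
    by rewrite mpolyXD.
  (* Cancellation in a domain: [xn] is nonzero, its support being a singleton. *)
  + move=> y z _ _; by apply: mulIf; rewrite -msupp_eq0 msuppX.
  + move=> _ [p + <-]; rewrite sPFE => -[q Gq <-].
    by exists 'X_[q]; [exists q | rewrite mpolyXD].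
(* Translation of exponents by [U_(l)] is injective, so it preserves cardinality. *)
- split=> //; rewrite sPFE fset_set_image // card_imfset //=.
  exact: addIm.
Qed.
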